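(* Let $\psi = \{\varepsilon_i : A \to \{a_i\}\}_{i\in X}$ and $\chi = \{F_j : B \to \{b_j\}\}_{j\in Y}$ be two experiments in an operational structure, where $A = \{a_i \mid i \in X\}$ and $B=\{b_j \mid j\in Y\}$. Then the sequential composition of $\psi$ followed by $\chi$ equals their parallel composition: $$\chi\circ\psi = \psi\otimes\chi ,$$ that is, $(I_{\{a_i\}}\otimes F_j)\circ(\varepsilon_i\otimes I_B) = \varepsilon_i\otimes F_j$ for every $(i,j)\in X\times Y$.
   Context: Events are arrows of a category whose objects are sets: an event of type $A\to B$ can be composed with an event of type $B\to C$; the composition $\circ$ is associative and each set $A$ has an identity event $I_A$ of type $A\to A$ satisfying $\varepsilon\circ I_A=\varepsilon$ and $I_A\circ F=F$ for all events $\varepsilon$ of type $A\to B$ and $F$ of type $B\to A$. In addition there is a parallel composition: events $\varepsilon$ of type $A\to A'$ and $F$ of type $B\to B'$ yield an event $\varepsilon\otimes F$ of type $A\times B\to A'\times B'$, subject to $(\varepsilon\otimes F)\circ(G\otimes H) = (\varepsilon\circ G)\otimes(F\circ H)$ (whenever the compositions are defined) and $I_{A\times B}=I_A\otimes I_B$. An experiment measuring a set $A=\{a_i\mid i\in X\}$ (with index set $X$, $|X|=|A|$, called the outcome space) is a family of events $\{\varepsilon_i\}_{i\in X}$ with $\varepsilon_i$ of type $A\to\{a_i\}$. For experiments $\psi=\{\varepsilon_i: A\to\{a_i\}\}_{i\in X}$ and $\chi=\{F_j: B\to\{b_j\}\}_{j\in Y}$: the parallel composition is the family $\psi\otimes\chi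 := \{\varepsilon_i\otimes F_j : A\times B\to\{(a_i,b_j)\}\}_{(i,j)\in X\times Y}$, where $\{a_i\}\times\{b_j\}=\{(a_i,b_j)\}$; the sequential composition is the family $\chi\circ\psi := \{(I_{\{a_i\}}\otimes F_j)\circ(\varepsilon_i\otimes I_B)\}_{(i,j)\in X\times Y}$ (first $\varepsilon_i$ occurs on the first factor while nothing happens on the second, then $F_j$ occurs on the second factor while nothing happens on the first). *)

(* Defs.v *)
From mathcomp Require Import all_boot.
From mathcomp Require Import boolp classical_sets functions cardinality.

Set Implicit Arguments.
Unset Strict Implicit.
Unset Printing Implicit Defensive.

Local Open Scope classical_set_scope.
Local Open Scope card_scope.

Declare Scope event_scope.
Delimit Scope event_scope with event.

Reserved Notation "g '\oE' f" (at level 50, left associativity).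
Reserved Notation "e '\oxE' f" (at level 40, left associativity).

(* The objects are the sets [A : set T], for an arbitrary ambient type [T], so
   that singletons of elements and cartesian products are again objects and
   {a} x {b} is equal, not merely isomorphic, to {(a, b)}.  No associativity
   or symmetry of the parallel composition is assumed. *)
Record opStructure := OpStructure {
  event : forall T U : Type, set T -> set U -> Type;
  evid : forall (T : Type) (A : set T), event A A;
  evcomp : forall (T U V : Type) (A : set T) (B : set U) (C : set V),
    event B C -> event A B -> event A C;
  evpar : forall (T T' U U' : Type)
      (A : set T) (A' : set T') (B : set U) (B' : set U'),
    event A A' -> event B B' -> event (A `*` B) (A' `*` B');
  evcompA : forall (T U V W : Type)
      (A : set T) (B : set U) (C : set V) (D : set W)
      (h : event C D) (g : event B C) (f : event A B),
    evcomp h (evcomp g f) = evcomp (evcomp h g) f;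
  evcomp1r : forall (T U : Type) (A : set T) (B : set U) (e : event A B),
    evcomp e (evid A) = e;
  evcomp1l : forall (T U : Type) (A : set T) (B : set U) (f : event B A),
    evcomp (evid A) f = f;
  evpar_comp : forall (T T' T'' U U' U'' : Type)
      (A : set T) (A' : set T') (A'' : set T'')
      (B : set U) (B' : set U') (B'' : set U'')
      (e : event A' A'') (g : event A A') (f : event B' B'') (h : event B B'),
    evcomp (evpar e f) (evpar g h) = evpar (evcomp e g) (evcomp f h);
  evid_par : forall (T U : Type) (A : set T) (B : set U),
    evid (A `*` B) = evpar (evid A) (evid B)
}.

Arguments evid {o T} A.

Notation "g '\oE' f" := (evcomp g f) : event_scope.
Notation "e '\oxE' f" := (evpar e f) : event_scope.

(* An experiment measuring A = {a_i | i in X} with outcome space [X], |X| = |A|.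
   The outcomes are pairwise distinct when [X] is finite; for infinite [X] no
   injectivity of [outcome] is required beyond equality of cardinals. *)
Record experiment (S : opStructure) (T : Type) (A : set T) (X : Type) :=
  Experiment {
  outcome : X -> T;
  outcome_range : A = range outcome;
  outcome_card : [set: X] #= A;
  expEvent : forall i : X, event S A [set outcome i]
}.

Lemma setX_set1 (T U : Type) (a : T) (b : U) :
  [set a] `*` [set b] = [set (a, b)].
Proof. by apply/seteqP; split=> [[x y] /= [-> ->]|[x y] /= [-> ->]]. Qed.

(* An event into {a} x {b}, seen as an event into the equal set {(a, b)}. *)
Definition to_pair1 (S : opStructure) (T U V : Type) (C : set V)
    (a : T) (b : U) (e : event S C ([set a] `*` [set b])) :
    event S C [set (a, b)] :=
  eq_rect _ (fun D : set (T * U) => event S C D) e _ (setX_set1 a b).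

Lemma range_pair (T U X Y : Type) (a : X -> T) (b : Y -> U)
    (A : set T) (B : set U) :
  A = range a -> B = range b ->
  A `*` B = range (fun ij : X * Y => (a ij.1, b ij.2)).
Proof.
move=> -> ->; apply/seteqP; split=> [[x y] /=|_ [[i j] _ <-] /=].
  by move=> [[i _ <-] [j _ <-]]; exists (i, j).
by split; [exists i | exists j].
Qed.

Lemma card_eq_pair (T U X Y : Type) (A : set T) (B : set U) :
  [set: X] #= A -> [set: Y] #= B -> [set: X * Y] #= A `*` B.
Proof.
move=> /card_bijP[f [f' fK f'K]] /card_bijP[g [g' gK g'K]].
pose inX (x : X) : [set: X] := SigSub (mem_set (I : [set: X] x)).
pose inY (y : Y) : [set: Y] := SigSub (mem_set (I : [set: Y] y)).
pose h (p : [set: X * Y]) : A `*` B :=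
  SigSub (mem_set (conj (set_valP (f (inX (val p).1)))
                        (set_valP (g (inY (val p).2)))
                   : (A `*` B) (val (f (inX (val p).1)),
                                val (g (inY (val p).2))))).
pose h1 (q : A `*` B) : A := SigSub (mem_set (proj1 (set_valP q))).
pose h2 (q : A `*` B) : B := SigSub (mem_set (proj2 (set_valP q))).
pose h' (q : A `*` B) : [set: X * Y] :=
  SigSub (mem_set (I : [set: X * Y] (val (f' (h1 q)), val (g' (h2 q))))).
apply/card_bijP; exists h, h' => [p|q]; apply/val_inj => /=.
  have -> : h1 (h p) = f (inX (val p).1) by exact/val_inj.
  have -> : h2 (h p) = g (inY (val p).2) by exact/val_inj.
  by rewrite fK gK /= -surjective_pairing.
have -> : inX (val (f' (h1 q))) = f' (h1 q) by exact/val_inj.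
have -> : inY (val (g' (h2 q))) = g' (h2 q) by exact/val_inj.
by rewrite f'K g'K /= -surjective_pairing.
Qed.

Section Composition.
Variables (S : opStructure) (T U : Type) (A : set T) (B : set U).
Variables (X Y : Type) (psi : experiment S A X) (chi : experiment S B Y).

Definition experiment_pair
    (ev : forall (i : X) (j : Y),
      event S (A `*` B) ([set outcome psi i] `*` [set outcome chi j])) :
    experiment S (A `*` B) (X * Y) :=
  Experiment
    (range_pair (outcome_range psi) (outcome_range chi))
    (card_eq_pair (outcome_card psi) (outcome_card chi))
    (fun ij => to_pair1 (ev ij.1 ij.2)).

Definition parComp : experiment S (A `*` B) (X * Y) :=
  experiment_pair (fun i j => expEvent psi i \oxE expEvent chi j)%event.

(* [psi] occurs first. *)
Definition seqComp : experiment S (A `*` B) (X * Y) :=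
  experiment_pair (fun i j =>
    (evid [set outcome psi i] \oxE expEvent chi j)
      \oE (expEvent psi i \oxE evid B))%event.

End Composition.

(* Main.v *)
Require Import Defs.
From mathcomp Require Import all_boot.
From mathcomp Require Import boolp classical_sets functions cardinality.

Local Open Scope classical_set_scope.
Local Open Scope event_scope.

Theorem mainTheorem6 (S : opStructure) (T U : Type) (A : set T) (B : set U)
    (X Y : Type) (psi : experiment S A X) (chi : experiment S B Y) :
  seqComp psi chi = parComp psi chi /\
  forall (i : X) (j : Y),
    (evid [set outcome psi i] \oxE expEvent chi j)
      \oE (expEvent psi i \oxE evid B)
    = expEvent psi i \oxE expEvent chi j.
Proof.
have seq_par i j : (evid [set outcome psi i] \oxE expEvent chi j)
    \oE (expEvent psi i \oxE evid B) = expEvent psi i \oxE expEvent chi j.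
  (* The interchange law composes factorwise, leaving an identity after [expEvent psi i] and one
     before [expEvent chi j]; the unit laws erase both. *)
  by rewrite evpar_comp evcomp1l evcomp1r.
(* Both experiments share outcomes, range and cardinality proofs through [experiment_pair], so only
   the event families must agree. Their types vary with [i] and [j], hence dependent
   extensionality. *)
split=> //; rewrite /seqComp /parComp; congr experiment_pair.
by apply: functional_extensionality_dep => i;
   apply: functional_extensionality_dep => j.
Qed.
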